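(* Fix a state $Q\ge 0$ and consider the revenue-sharing problem $$\max_{p,q,\gamma}\ q\quad\text{s.t.}\quad D\!\left(\frac{p}{e(Q)}\right)\le f(Q),\quad C_S(Q)+kq\le(1-\gamma)R(p,Q),\quad C_2(Q)\le\gamma R(p,Q),\quad q\ge0,\ p\ge 0,\ \gamma\in[0,1].$$ Suppose its optimal solution exhibits strictly positive expansion $q^*(Q)>0$. Let $p^*(Q)$ denote the optimal price in the integrated problem (maximize $q$ over $p,q\ge0$ subject to $D(p/e(Q))\le f(Q)$ and $C(Q)+kq\le R(p,Q)$), and let $R^*(Q)=R(p^*(Q),Q)$. Then an optimal revenue share is given by $$\gamma^*(Q)=\max\left\{0,\frac{C_2(Q)}{R^*(Q)}\right\}.$$ In particular, if $C_2(Q)\le 0$, then $\gamma^*(Q)=0$. If $C_2(Q)>0$ and $\gamma^*(Q)\in(0,1)$, then the generator viability constraint binds at the optimum: $C_2(Q)=\gamma^*(Q)R^*(Q)$.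
   Context: Constants: $M>0$, $\epsilon>0$, $k>0$. Real-valued functions of the renewable capacity $Q\ge 0$: emissions intensity $e(Q)>0$ with $e'(Q)<0$; delivered renewable electricity $f(Q)\ge 0$ with $f(0)=0$, $f'(Q)>0$, $f''(Q)<0$; marginal wholesale value $\pi(Q)$ with $\pi'(Q)<0$; costs $C_R(Q)\ge 0$, $C_S(Q)\ge 0$. Demand is $D(x)=M\exp(-\epsilon x)$; revenue is $R(p,Q)=p\,D(p/e(Q))$. The generator-side net cost is $C_2(Q)=C_R(Q)-f(Q)\pi(Q)$, and the integrated non-investment cost is $C(Q)=C_S(Q)+C_2(Q)$. The generator viability constraint is $C_2(Q)\le\gamma R(p,Q)$. The variable $\gamma$ is the fraction of revenue transferred to renewable generators. *)

(* Defs.v *)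
From Stdlib Require Import Reals.
Open Scope R_scope.

(* States are the reals [Q >= 0]; values of the functions below at negative
   arguments are irrelevant.  Derivatives are taken relative to this domain by
   [D_in], hence are right derivatives at 0. *)
Definition capacity (Q : R) : Prop := 0 <= Q.

Record market : Type := Market {
  M : R;
  eps : R;
  k : R;
  e : R -> R;                (* emissions intensity *)
  e' : R -> R;
  deliv : R -> R;            (* delivered renewable electricity, written f *)
  deliv' : R -> R;
  deliv'' : R -> R;
  wholesale : R -> R;        (* marginal wholesale value, written pi *)
  wholesale' : R -> R;
  C_R : R -> R;
  C_S : R -> R;
  M_pos : 0 < M;
  eps_pos : 0 < eps;
  k_pos : 0 < k;
  e_pos : forall Q, capacity Q -> 0 < e Q;
  e_deriv : forall Q, capacity Q -> D_in e e' capacity Q;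
  e'_neg : forall Q, capacity Q -> e' Q < 0;
  deliv_nonneg : forall Q, capacity Q -> 0 <= deliv Q;
  deliv_0 : deliv 0 = 0;
  deliv_deriv : forall Q, capacity Q -> D_in deliv deliv' capacity Q;
  deliv'_pos : forall Q, capacity Q -> 0 < deliv' Q;
  deliv'_deriv : forall Q, capacity Q -> D_in deliv' deliv'' capacity Q;
  deliv''_neg : forall Q, capacity Q -> deliv'' Q < 0;
  wholesale_deriv :
    forall Q, capacity Q -> D_in wholesale wholesale' capacity Q;
  wholesale'_neg : forall Q, capacity Q -> wholesale' Q < 0;
  C_R_nonneg : forall Q, capacity Q -> 0 <= C_R Q;
  C_S_nonneg : forall Q, capacity Q -> 0 <= C_S Q
}.

Definition demand (m : market) (x : R) : R := M m * exp (- eps m * x).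

Definition revenue (m : market) (p Q : R) : R := p * demand m (p / e m Q).

Definition C_2 (m : market) (Q : R) : R := C_R m Q - deliv m Q * wholesale m Q.

Definition C_integrated (m : market) (Q : R) : R := C_S m Q + C_2 m Q.

Definition integrated_feasible (m : market) (Q p q : R) : Prop :=
  demand m (p / e m Q) <= deliv m Q /\
  C_integrated m Q + k m * q <= revenue m p Q /\
  0 <= q /\ 0 <= p.

Definition integrated_optimal (m : market) (Q p q : R) : Prop :=
  integrated_feasible m Q p q /\
  forall p1 q1 : R, integrated_feasible m Q p1 q1 -> q1 <= q.

Definition integrated_optimal_price (m : market) (Q p : R) : Prop :=
  exists q : R, integrated_optimal m Q p q.

Definition sharing_feasible (m : market) (Q p q gamma : R) : Prop :=
  demand m (p / e m Q) <= deliv m Q /\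
  C_S m Q + k m * q <= (1 - gamma) * revenue m p Q /\
  C_2 m Q <= gamma * revenue m p Q /\
  0 <= q /\ 0 <= p /\ 0 <= gamma <= 1.

Definition sharing_optimal (m : market) (Q p q gamma : R) : Prop :=
  sharing_feasible m Q p q gamma /\
  forall p1 q1 gamma1 : R, sharing_feasible m Q p1 q1 gamma1 -> q1 <= q.

Definition optimal_revenue_share (m : market) (Q gamma : R) : Prop :=
  exists p q : R, sharing_optimal m Q p q gamma.

(* Main.v *)
(* At fixed Q both problems, once q is eliminated, ask for the largest revenue
   over the same set of prices; so the integrated optimal price also solves the
   sharing problem.  A share gamma costs the investor gamma R(p,Q), which is at
   least max(0, C_2(Q)), and gamma* attains this lower bound at the price p*. *)
Require Import Defs.
From Stdlib Require Import Reals Lra.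
Open Scope R_scope.

Lemma revenue_nonneg (m : market) (p Q : R) : 0 <= p -> 0 <= revenue m p Q.
Proof.
  intros Hp; unfold revenue, demand.
  repeat apply Rmult_le_pos; try lra.
  - pose proof (M_pos m); lra.
  - left; apply exp_pos.
Qed.

Lemma integrated_optimal_price_max_revenue (m : market) (Q pstar p : R) :
  integrated_optimal_price m Q pstar ->
  0 <= p -> demand m (p / e m Q) <= deliv m Q ->
  revenue m p Q <= revenue m pstar Q.
Proof.
  intros [q [[_ [Hbudget [Hq _]]] Hopt]] Hp Hd.
  destruct (Rle_or_lt (revenue m p Q) (revenue m pstar Q)) as [H|Hlt]; [exact H|].
  exfalso.
  pose proof (k_pos m) as Hk.
  (* spend the whole extra revenue on expansion *)
  set (d := (revenue m p Q - revenue m pstar Q) / k m).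
  assert (Hd0 : 0 < d) by (apply Rdiv_lt_0_compat; lra).
  assert (Hkd : k m * d = revenue m p Q - revenue m pstar Q)
    by (unfold d; field; lra).
  assert (Hle : q + d <= q).
  { apply (Hopt p); repeat split; try assumption; lra. }
  lra.
Qed.

(** Adding the investor and generator constraints cancels [gamma]. The transfer is at least [C_2] by
    viability and at least 0 by sign, so the resulting bound on [q] is the same for every share. *)
Lemma sharing_feasible_budget (m : market) (Q p q gamma : R) :
  sharing_feasible m Q p q gamma ->
  C_S m Q + k m * q + Rmax 0 (C_2 m Q) <= revenue m p Q.
Proof.
  intros [_ [Hinv [Hgen [_ [Hp [Hg _]]]]]].
  assert (H : Rmax 0 (C_2 m Q) <= gamma * revenue m p Q).
  { apply Rmax_lub; [|exact Hgen].
    apply Rmult_le_pos; [exact Hg | now apply revenue_nonneg]. }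
  lra.
Qed.

Lemma Rmax_0_div_mul (x r : R) : 0 < r -> Rmax 0 (x / r) * r = Rmax 0 x.
Proof.
  intros Hr.
  rewrite Rmult_comm, <- RmaxRmult by lra.
  f_equal; field; lra.
Qed.

Theorem proposition3 (m : market) (Q : R) (hQ : 0 <= Q)
    (hexp : exists p q gamma : R, sharing_optimal m Q p q gamma /\ 0 < q)
    (pstar : R) (hpstar : integrated_optimal_price m Q pstar) :
  let Rstar := revenue m pstar Q in
  let gammastar := Rmax 0 (C_2 m Q / Rstar) in
  optimal_revenue_share m Q gammastar /\
  (C_2 m Q <= 0 -> gammastar = 0) /\
  (0 < C_2 m Q -> 0 < gammastar < 1 ->
     C_2 m Q = gammastar * Rstar /\
     forall p q : R, sharing_optimal m Q p q gammastar ->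
       C_2 m Q = gammastar * revenue m p Q).
Proof.
  intros Rstar gammastar.
  assert (Hmax : forall p q gamma, sharing_feasible m Q p q gamma ->
                   revenue m p Q <= Rstar).
  { intros p q gamma [Hd [_ [_ [_ [Hp _]]]]].
    now apply integrated_optimal_price_max_revenue. }
  pose proof (k_pos m) as Hk.
  pose proof (C_S_nonneg m Q hQ) as HCS.
  pose proof (Rmax_l 0 (C_2 m Q)) as Hc0.
  pose proof (Rmax_r 0 (C_2 m Q)) as Hc2.
  (* Positive expansion enters here: the given optimum has [k m * q > 0] within a budget of at most
     [Rstar]. Hence [Rstar > 0], so the quotient in [gammastar] is a genuine division. *)
  assert (Hsurplus : 0 < Rstar - C_S m Q - Rmax 0 (C_2 m Q)).
  { destruct hexp as [p [q [gamma [[Hf _] Hq]]]].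
    pose proof (sharing_feasible_budget _ _ _ _ _ Hf).
    pose proof (Hmax _ _ _ Hf).
    pose proof (Rmult_lt_0_compat _ _ Hk Hq).
    lra. }
  assert (HR : 0 < Rstar) by lra.
  assert (Hshare : gammastar * Rstar = Rmax 0 (C_2 m Q))
    by now apply Rmax_0_div_mul.
  split; [|split].
  (* This [q] exhausts the investor's budget at [pstar], turning the budget bound into an
     equality. *)
  - set (q := (Rstar - C_S m Q - Rmax 0 (C_2 m Q)) / k m).
    assert (Hkq : k m * q = Rstar - C_S m Q - Rmax 0 (C_2 m Q))
      by (unfold q; field; lra).
    exists pstar, q; split.
    + destruct hpstar as [q0 [[Hd [_ [_ Hp]]] _]].
      repeat split; try assumption; fold Rstar.
      * lra.
      * lra.
      * left; apply Rdiv_lt_0_compat; lra.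
      * apply Rmax_l.
      (* [gammastar <= 1], because the surplus is positive and [C_S] is nonnegative. *)
      * apply Rmult_le_reg_r with Rstar; lra.
    + intros p1 q1 gamma1 Hf.
      pose proof (sharing_feasible_budget _ _ _ _ _ Hf).
      pose proof (Hmax _ _ _ Hf).
      apply Rmult_le_reg_l with (k m); lra.
  - intros HC.
    apply Rmult_eq_reg_r with Rstar; [|lra].
    rewrite Hshare, Rmax_left; lra.
  - intros HC [Hg _].
    rewrite Rmax_right in Hshare by lra.
    split; [lra|].
    intros p q [Hf _].
    (* The transfer at [p] is at most [gammastar * Rstar = C_2 m Q]; viability gives the reverse
       inequality. *)
    pose proof (Rmult_le_compat_l gammastar _ _ (Rlt_le _ _ Hg) (Hmax _ _ _ Hf)).
    destruct Hf as [_ [_ [Hgen _]]].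
    lra.
Qed.
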